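(* Let $R$ be a commutative computable ring and $\mathfrak{m}$ a finitely generated maximal ideal in $R$. Let $A\in R_{\mathfrak m}^{m\times n}$. Rewrite $A=\frac{\tilde{A}}{\tilde a}$ with $\tilde{A}\in R^{m\times n}$ and $\tilde a\in R\setminus\mathfrak m$. If $\tilde{X}\in R^{k\times m}$ is a matrix of generating syzygies for $\tilde{A}$ (over $R$), then the matrix $X:=\frac{\tilde{X}}{1}$ is a matrix of generating syzygies of $A$ (over $R_{\mathfrak m}$).
   Context: $R_{\mathfrak m}$ is the localization of $R$ at $\mathfrak m$, i.e. $S^{-1}R$ with $S=R\setminus\mathfrak m$. For a matrix $\tilde C$ over $R$ and $s\in S$, $\frac{\tilde C}{s}$ denotes the matrix over $R_{\mathfrak m}$ with entries $\tilde C_{ij}/s$. For a ring $Q$ and $A\in Q^{r_1\times r_0}$, a matrix $X\in Q^{r_2\times r_1}$ is called a matrix of generating syzygies (of the rows) of $A$ if the rows of $X$ form a generating set of the kernel of the map $Q^{1\times r_1}\to Q^{1\times r_0}$, $x\mapsto xA$. A ring $R$ is computable if linear systems over it can be effectively solved: there are algorithms which, for matrices $A,B$ over $R$ with the same number of columns, compute (i) a matrix of generating syzygies of $A$, and (ii) matrices $N,T$ with $N=TA+B$ such that the $i$-th row of $N$ is zero whenever the $i$-th row of $B$ is an $R$-linear combination of the rows of $A$; and likewise for the transposed systems $AX=B$. *)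

(* Defs.v *)
From HB Require Import structures.
From mathcomp Require Import all_boot all_order all_algebra generic_quotient.
From mathcomp Require Import ring_quotient boolp ring.

Set Implicit Arguments.
Unset Strict Implicit.
Unset Printing Implicit Defensive.

Import GRing.Theory.
Local Open Scope ring_scope.
Local Open Scope quotient_scope.

(* The ideals of type [idealr R] are proper by definition, hence maximality
   among the proper ideals is inclusion-maximality in [idealr R].             *)
HB.mixin Record isMaximalIdealr (R : nzRingType) (M : R -> bool) := {
  maximal_idealr_subproof :
    forall J : idealr R, {subset M <= J} -> {subset J <= M}
}.

#[short(type="maximal_idealr")]
HB.structure Definition MaximalIdealr (R : nzRingType) :=
  {M of Idealr R M & isMaximalIdealr R M}.

Definition finitely_generated_ideal (R : comNzRingType) (I : {pred R}) : Prop :=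
  exists (r : nat) (g : 'I_r -> R),
    forall x, x \in I <-> exists c : 'I_r -> R, x = \sum_(i < r) c i * g i.

Section MaximalIdeal.
Variables (R : comNzRingType) (M : maximal_idealr R).

Lemma maximal_idealr_prime : prime_idealr_closed M.
Proof.
move=> u v uvM; have [//|uM/=] := boolP (u \in M).
pose J : {pred R} := fun x => `[< exists a, x - a * u \in M >].
have [oneJ|oneJ] := pselect (1 \in J).
  have /asboolP[a auM] : `[< exists a, 1 - a * u \in M >] := oneJ.
  have -> : v = v * (1 - a * u) + a * (u * v).
    by ring.
  by apply: rpredD => //; apply: idealMr.
have Jid : idealr_closed J.
  split; first by apply/asboolP; exists 0; rewrite mul0r subr0 rpred0.
    exact/negP.
  move=> a x y /asboolP[b xM] /asboolP[c yM]; apply/asboolP.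
  exists (a * b + c).
  have -> : a * x + y - (a * b + c) * u = a * (x - b * u) + (y - c * u).
    by ring.
  by apply: rpredD => //; apply: idealMr.
pose J' := isIdealr.Build R J Jid.
pose JI : idealr R := HB.pack J J'.
have uJ : u \in JI by apply/asboolP; exists 1; rewrite mul1r subrr rpred0.
case/negP: uM; apply: (@maximal_idealr_subproof R M JI _ _ uJ).
by move=> x xM; apply/asboolP; exists 0; rewrite mul0r subr0.
Qed.

Definition ideal_compl : {pred R} := [pred x | x \notin M].

Lemma ideal_compl_mulr_closed : mulr_closed ideal_compl.
Proof.
split=> [|x y]; rewrite !inE ?idealr1 // => xM yM.
by apply/negP => /maximal_idealr_prime; rewrite (negPf xM) (negPf yM).
Qed.

HB.instance Definition _ :=
  GRing.isMulClosed.Build R ideal_compl ideal_compl_mulr_closed.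

End MaximalIdeal.

(* The ring S^-1 R. Since R may have zero divisors, r / s = r' / s' means that
   u (r s' - r' s) = 0 for some u in S.                                       *)
Module Localization.
Section Localization.
Variables (R : comNzRingType) (S : mulrClosed R).

Definition prefrac := {x : R * R | x.2 \in S}.
HB.instance Definition _ := Choice.on prefrac.
Implicit Types x y z : prefrac.
Local Notation num x := (val x).1.
Local Notation den x := (val x).2.

Definition Prefrac (r s : R) (sS : s \in S) : prefrac :=
  exist (fun x : R * R => x.2 \in S) (r, s) sS.

Definition equivl x y : bool :=
  `[< exists2 u, u \in S & u * (num x * den y - num y * den x) = 0 >].

Lemma equivl_refl : reflexive equivl.
Proof. by move=> x; apply/asboolP; exists 1; rewrite ?rpred1 // subrr mulr0. Qed.

Lemma equivl_sym : symmetric equivl.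
Proof.
suff h x y : equivl x y -> equivl y x by move=> x y; apply/idP/idP; apply: h.
move=> /asboolP[u uS e]; apply/asboolP; exists u => //.
by rewrite -opprB mulrN e oppr0.
Qed.

Lemma equivl_trans : transitive equivl.
Proof.
move=> y x z /asboolP[u uS e] /asboolP[v vS f]; apply/asboolP.
exists (u * v * den y); first by rewrite !rpredM // (valP y).
have -> : u * v * den y * (num x * den z - num z * den x) =
   v * den z * (u * (num x * den y - num y * den x)) +
   u * den x * (v * (num y * den z - num z * den y)).
  by ring.
by rewrite e f !mulr0 addr0.
Qed.

Canonical equivl_equiv := EquivRel equivl equivl_refl equivl_sym equivl_trans.

Definition type := {eq_quot equivl}.
HB.instance Definition _ : EqQuotient _ equivl type := EqQuotient.on type.
HB.instance Definition _ := Choice.on type.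

Definition frac (r s : R) (sS : s \in S) : type := \pi_type (Prefrac r sS).

Lemma eq_frac r s sS r' s' s'S :
  @frac r s sS = @frac r' s' s'S <->
  exists2 u, u \in S & u * (r * s' - r' * s) = 0.
Proof.
by split=> [/eqmodP/asboolP//|h]; apply/eqmodP/asboolP.
Qed.

Lemma fracW (P : type -> Prop) :
  (forall r s sS, P (@frac r s sS)) -> forall a, P a.
Proof. move=> h a; rewrite -[a]reprK; case: (repr a) => -[r s] sS; exact: h. Qed.

Definition addp x y : prefrac :=
  Prefrac (num x * den y + num y * den x) (rpredM (valP x) (valP y)).
Definition oppp x : prefrac := Prefrac (- num x) (valP x).
Definition mulp x y : prefrac :=
  Prefrac (num x * num y) (rpredM (valP x) (valP y)).

Definition zero : type := frac 0 (rpred1 S).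
Definition one : type := frac 1 (rpred1 S).
Definition add (a b : type) : type := \pi_type (addp (repr a) (repr b)).
Definition opp (a : type) : type := \pi_type (oppp (repr a)).
Definition mul (a b : type) : type := \pi_type (mulp (repr a) (repr b)).

Lemma repr_frac r s sS : exists2 u, u \in S &
  u * (num (repr (@frac r s sS)) * s) = u * (r * den (repr (@frac r s sS))).
Proof.
have /eqmodP/asboolP[u uS] : repr (@frac r s sS) = Prefrac r sS %[mod type].
  by rewrite reprK.
by move=> /= /eqP; rewrite mulrBr subr_eq0 => /eqP e; exists u.
Qed.

Lemma addE r s sS r' s' s'S : add (@frac r s sS) (@frac r' s' s'S) =
  frac (r * s' + r' * s) (rpredM sS s'S).
Proof.
have [u uS e] := repr_frac r sS; have [v vS f] := repr_frac r' s'S.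
apply/eqmodP/asboolP => /=; exists (u * v); first by rewrite rpredM.
move: e f; set a := num _; set b := den _; set c := num _; set d := den _.
move=> e f; apply/eqP; rewrite mulrBr subr_eq0; apply/eqP.
have -> : u * v * ((a * d + c * b) * (s * s')) =
  u * (a * s) * (v * d * s') + v * (c * s') * (u * b * s).
  by ring.
by rewrite e f; ring.
Qed.

Lemma oppE r s sS : opp (@frac r s sS) = frac (- r) sS.
Proof.
have [u uS e] := repr_frac r sS.
apply/eqmodP/asboolP => /=; exists u => //.
by rewrite !mulNr -opprD mulrN mulrDr mulrN e subrr oppr0.
Qed.

Lemma mulE r s sS r' s' s'S : mul (@frac r s sS) (@frac r' s' s'S) =
  frac (r * r') (rpredM sS s'S).
Proof.
have [u uS e] := repr_frac r sS; have [v vS f] := repr_frac r' s'S.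
apply/eqmodP/asboolP => /=; exists (u * v); first by rewrite rpredM.
move: e f; set a := num _; set b := den _; set c := num _; set d := den _.
move=> e f; apply/eqP; rewrite mulrBr subr_eq0; apply/eqP.
have -> : u * v * (a * c * (s * s')) = u * (a * s) * (v * (c * s')).
  by ring.
by rewrite e f; ring.
Qed.

Lemma frac_eq r s sS r' s' s'S :
  r * s' = r' * s -> @frac r s sS = @frac r' s' s'S.
Proof.
by move=> e; apply/eq_frac; exists 1; rewrite ?rpred1 // e subrr mulr0.
Qed.

Lemma addA : associative add.
Proof.
elim/fracW=> a s sS; elim/fracW=> b t tS; elim/fracW=> c u uS.
by rewrite !addE; apply: frac_eq; ring.
Qed.

Lemma addC : commutative add.
Proof.
elim/fracW=> a s sS; elim/fracW=> b t tS.
by rewrite !addE; apply: frac_eq; ring.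
Qed.

Lemma add0 : left_id zero add.
Proof.
by elim/fracW=> a s sS; rewrite addE; apply: frac_eq; ring.
Qed.

Lemma addN : left_inverse zero opp add.
Proof.
by elim/fracW=> a s sS; rewrite oppE addE; apply: frac_eq; ring.
Qed.

HB.instance Definition _ := GRing.isZmodule.Build type addA addC add0 addN.

Lemma mulA : associative mul.
Proof.
elim/fracW=> a s sS; elim/fracW=> b t tS; elim/fracW=> c u uS.
by rewrite !mulE; apply: frac_eq; ring.
Qed.

Lemma mulC : commutative mul.
Proof.
elim/fracW=> a s sS; elim/fracW=> b t tS.
by rewrite !mulE; apply: frac_eq; ring.
Qed.

Lemma mul1 : left_id one mul.
Proof.
by elim/fracW=> a s sS; rewrite mulE; apply: frac_eq; ring.
Qed.

Lemma mulD : left_distributive mul add.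
Proof.
elim/fracW=> a s sS; elim/fracW=> b t tS; elim/fracW=> c u uS.
by rewrite !(mulE, addE); apply: frac_eq; ring.
Qed.

HB.instance Definition _ :=
  GRing.Zmodule_isComPzRing.Build type mulA mulC mul1 mulD.

End Localization.
End Localization.

HB.export Localization.

(* [localization_at M] is the localization of R at the maximal ideal M, and
   [Localization.frac r sS] is the fraction r / s, where sS : s \in S.        *)
Notation localization_at M := (Localization.type (ideal_compl M)).

Definition fracmx (R : comNzRingType) (S : mulrClosed R) (m n : nat)
    (A : 'M[R]_(m, n)) (s : R) (sS : s \in S) :
    'M[Localization.type S]_(m, n) :=
  map_mx (fun x => Localization.frac x sS) A.

(* Every matrix over a localization admits a common denominator.              *)
Lemma fracmx_exists (R : comNzRingType) (S : mulrClosed R) (m n : nat)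
    (A : 'M[Localization.type S]_(m, n)) :
  exists (B : 'M[R]_(m, n)) (s : R) (sS : s \in S), A = fracmx B sS.
Proof.
have Aij (ij : 'I_m * 'I_n) :
    exists rs : R * R, exists sS : rs.2 \in S,
      A ij.1 ij.2 = Localization.frac rs.1 sS.
  by elim/Localization.fracW: (A _ _) => r s sS; exists (r, s), sS.
have [f fP] := choice Aij.
have fS ij : (f ij).2 \in S by have [] := fP ij.
have dS (P : pred ('I_m * 'I_n)) : \prod_(ij | P ij) (f ij).2 \in S.
  exact: rpred_prod.
exists (\matrix_(i, j) ((f (i, j)).1 * \prod_(kl | kl != (i, j)) (f kl).2)).
exists (\prod_kl (f kl).2), (dS predT); apply/matrixP => i j; rewrite !mxE.
have [sS /= ->] := fP (i, j); apply: Localization.frac_eq.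
by rewrite (bigD1 (i, j)) //=; ring.
Qed.

Section GeneratingSyzygies.
Variable Q : comPzRingType.

Definition in_row_span (p n : nat) (A : 'M[Q]_(p, n)) (x : 'rV[Q]_n) : Prop :=
  exists c : 'I_p -> Q, x = \sum_(i < p) c i *: row i A.

Definition in_col_span (m p : nat) (A : 'M[Q]_(m, p)) (x : 'cV[Q]_m) : Prop :=
  exists c : 'I_p -> Q, x = \sum_(j < p) c j *: col j A.

Definition generating_syzygies (r2 r1 r0 : nat)
    (A : 'M[Q]_(r1, r0)) (X : 'M[Q]_(r2, r1)) : Prop :=
  forall x : 'rV[Q]_r1, x *m A = 0 <-> in_row_span X x.

Definition generating_col_syzygies (r2 r1 r0 : nat)
    (A : 'M[Q]_(r0, r1)) (X : 'M[Q]_(r1, r2)) : Prop :=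
  forall x : 'cV[Q]_r1, A *m x = 0 <-> in_col_span X x.

End GeneratingSyzygies.

(* The algorithms of a computable ring are carried as data. No model of
   computation is imposed: an algorithm is a function of the type theory.     *)
Record computable_ring (R : comPzRingType) : Type := ComputableRing {
  row_syz : forall m n, 'M[R]_(m, n) -> {k : nat & 'M[R]_(k, m)};
  row_syzP : forall m n (A : 'M[R]_(m, n)),
    generating_syzygies A (tagged (row_syz A));
  (* [row_reduce A B] is the pair (N, T) *)
  row_reduce : forall m n p,
    'M[R]_(m, n) -> 'M[R]_(p, n) -> 'M[R]_(p, n) * 'M[R]_(p, m);
  row_reduceE : forall m n p (A : 'M[R]_(m, n)) (B : 'M[R]_(p, n)),
    (row_reduce A B).1 = (row_reduce A B).2 *m A + B;
  row_reduce0 : forall m n p (A : 'M[R]_(m, n)) (B : 'M[R]_(p, n)) (i : 'I_p),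
    in_row_span A (row i B) -> row i (row_reduce A B).1 = 0;
  col_syz : forall m n, 'M[R]_(m, n) -> {k : nat & 'M[R]_(n, k)};
  col_syzP : forall m n (A : 'M[R]_(m, n)),
    generating_col_syzygies A (tagged (col_syz A));
  col_reduce : forall m n p,
    'M[R]_(m, n) -> 'M[R]_(m, p) -> 'M[R]_(m, p) * 'M[R]_(n, p);
  col_reduceE : forall m n p (A : 'M[R]_(m, n)) (B : 'M[R]_(m, p)),
    (col_reduce A B).1 = A *m (col_reduce A B).2 + B;
  col_reduce0 : forall m n p (A : 'M[R]_(m, n)) (B : 'M[R]_(m, p)) (j : 'I_p),
    in_col_span A (col j B) -> col j (col_reduce A B).1 = 0
}.

(* Main.v *)
Require Import Defs.
From mathcomp Require Import all_boot all_order all_algebra ring_quotient.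
From mathcomp Require Import ring.

Import GRing.Theory.
Local Open Scope ring_scope.

(** Localization is exact, hence it commutes with kernels. Concretely, let
    [x = xt / s] satisfy [x *m A = 0]. Then [(xt *m At) / (s * a)] is zero in
    the localization, so by [fracmx_eq0] some denominator [u] kills
    [xt *m At], which says that [u *: xt] is a syzygy of [At] over [R]. It is
    therefore a combination [c *m Xt], and dividing by [s * u] gives
    [x = (c / (s * u)) *m (Xt / 1)]. In the other direction, the rows of [Xt]
    being syzygies amounts to [Xt *m At = 0], an equation that fractions
    preserve by [fracmxM].

    The argument works for every multiplicative set of denominators
    ([generating_syzygies_fracmx]). *)

Lemma in_row_spanP (Q : comPzRingType) (p n : nat) (A : 'M[Q]_(p, n))
    (x : 'rV[Q]_n) :
  in_row_span A x <-> exists c : 'rV[Q]_p, x = c *m A.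
Proof.
split=> [[c ->]|[c ->]].
  exists (\row_i c i); rewrite mulmx_sum_row.
  by apply: eq_bigr => i _; rewrite mxE.
by exists (c 0); rewrite mulmx_sum_row.
Qed.

Lemma generating_syzygies_mul0 {Q : comPzRingType} {k m n : nat}
    {A : 'M[Q]_(m, n)} {X : 'M[Q]_(k, m)} :
  generating_syzygies A X -> X *m A = 0.
Proof.
move=> genX; apply/row_matrixP => i; rewrite row_mul row0.
by apply/genX/in_row_spanP; exists (delta_mx 0 i); rewrite -rowE.
Qed.

Section FractionMatrices.
Variables (R : comNzRingType) (S : mulrClosed R).

Lemma frac0 (s : R) (sS : s \in S) : Localization.frac 0 sS = 0.
Proof. by apply: Localization.frac_eq; rewrite !mul0r. Qed.

Lemma frac_sum (I : Type) (r : seq I) (F : I -> R) (s : R) (sS : s \in S) :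
  Localization.frac (\sum_(i <- r) F i) sS =
  \sum_(i <- r) Localization.frac (F i) sS.
Proof.
elim: r => [|i r IHr]; first by rewrite !big_nil frac0.
rewrite !big_cons -IHr; symmetry.
apply: etrans (Localization.addE _ _ _ _) _.
by apply: Localization.frac_eq; ring.
Qed.

Lemma fracmx_eq (m n : nat) (A B : 'M[R]_(m, n)) (s t : R)
    (sS : s \in S) (tS : t \in S) :
  t *: A = s *: B -> fracmx A sS = fracmx B tS.
Proof.
move=> eqAB; apply/matrixP => i j; rewrite !mxE; apply: Localization.frac_eq.
by move/matrixP: eqAB => /(_ i j); rewrite !mxE mulrC => ->; rewrite mulrC.
Qed.

Lemma fracmx0 (m n : nat) (s : R) (sS : s \in S) :
  fracmx (0 : 'M[R]_(m, n)) sS = 0.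
Proof. by apply/matrixP => i j; rewrite !mxE frac0. Qed.

(** Each entry is killed by its own denominator; the product of these finitely
    many denominators kills all entries at once. *)
Lemma fracmx_eq0 (m n : nat) (A : 'M[R]_(m, n)) (s : R) (sS : s \in S) :
  fracmx A sS = 0 -> exists2 u, u \in S & u *: A = 0.
Proof.
move=> A0.
have killA (ij : 'I_m * 'I_n) : exists u, u \in S /\ u * A ij.1 ij.2 = 0.
  have /matrixP/(_ ij.1 ij.2) := A0; rewrite !mxE => /Localization.eq_frac[u uS].
  by rewrite mul0r subr0 mulr1 => uA0; exists u.
have [f fP] := boolp.choice killA.
exists (\prod_ij f ij); first by apply: rpred_prod => ij _; case: (fP ij).
apply/matrixP => i j; rewrite !mxE (bigD1 (i, j)) //= mulrAC.
by have [_ /= ->] := fP (i, j); rewrite mul0r.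
Qed.

Lemma fracmxM (m n p : nat) (A : 'M[R]_(m, n)) (B : 'M[R]_(n, p)) (s t : R)
    (sS : s \in S) (tS : t \in S) :
  fracmx A sS *m fracmx B tS = fracmx (A *m B) (rpredM sS tS).
Proof.
apply/matrixP => i j; rewrite !mxE frac_sum; apply: eq_bigr => l _.
by rewrite !mxE; apply: Localization.mulE.
Qed.

Lemma generating_syzygies_fracmx (k m n : nat) (A : 'M[R]_(m, n))
    (X : 'M[R]_(k, m)) (s t : R) (sS : s \in S) (tS : t \in S) :
  generating_syzygies A X -> generating_syzygies (fracmx A sS) (fracmx X tS).
Proof.
move=> genX x; split=> [xA0|/in_row_spanP[c ->]]; last first.
  by rewrite -mulmxA fracmxM (generating_syzygies_mul0 genX) fracmx0 mulmx0.
have [y [d [dS eqx]]] := fracmx_exists x; subst x.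
move: xA0; rewrite fracmxM => /fracmx_eq0[u uS].
rewrite scalemxAl => /genX/in_row_spanP[c eqc].
apply/in_row_spanP.
(* From [u *: y = c *m X] one gets [y / d = (t *: c) / (d * u) *m (X / t)]. *)
exists (fracmx (t *: c) (rpredM dS uS)).
rewrite fracmxM; apply: fracmx_eq.
by rewrite -scalemxAl -eqc !scalerA; congr (_ *: _); ring.
Qed.

End FractionMatrices.

Theorem lemma4p3 (R : comNzRingType) (compR : computable_ring R)
    (M : maximal_idealr R) (fgM : finitely_generated_ideal M)
    (m n k : nat) (A : 'M[localization_at M]_(m, n))
    (At : 'M[R]_(m, n)) (a : R) (aM : a \in ideal_compl M)
    (eqA : A = fracmx At aM) (Xt : 'M[R]_(k, m)) :
  generating_syzygies At Xt ->
  generating_syzygies A (fracmx Xt (rpred1 (ideal_compl M))).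
Proof. by rewrite eqA; apply: generating_syzygies_fracmx. Qed.
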